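(* For all positive integers $N$ and all integers $m\ge 8N$, $\mathrm{cr}_3(N,m)\in\Omega\bigl((m^2/N)\log(m/N)\bigr)$. That is, there is an absolute constant $c>0$ such that for all positive integers $N$ and all integers $m\ge 8N$, every (proper) 3-dimensional geometric grid graph with exactly $m$ edges and volume at most $N$ has at least $c\,(m^2/N)\log(m/N)$ crossings.
   Context: Let $\mathbb{N}=\{1,2,3,\dots\}$. For positive integers $X_1,\dots,X_d$, the $X_1\times\cdots\times X_d$ grid is the set $\{(x_1,\dots,x_d): x_i\in\{1,\dots,X_i\}\text{ for all }i\}\subset\mathbb{N}^d$; its volume is $\prod_{i=1}^d X_i$. A $d$-dimensional geometric grid graph $G$ is a finite simple graph whose vertex set is a subset of $\mathbb{N}^d$; each edge $uw$ is identified with the open straight line segment with endpoints $u$ and $w$. All geometric grid graphs are assumed to be proper: for every edge $uw\in E(G)$ and every vertex $x\in V(G)$, the point $x$ does not lie on the open segment $uw$. The volume $\mathrm{vol}(G)$ is the volume of the minimal $X_1\times\cdots\times X_d$ grid containing $V(G)$. Two distinct edges of $G$ cross (form a crossing) if, as open segments, they have a point in common; $\mathrm{cr}(G)$ is the number of crossings, i.e. of unordered pairs of distinct edges that cross. Define $\mathrm{cr}_d(N,m)=\min\{\mathrm{cr}(G): G\text{ is a }d\text{-dimensional (proper) geometric grid graph, } |E(G)|=m,\ \mathrm{vol}(G)\le N\}$ (the minimum over the empty set being $+\infty$). *)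

(* Defs.v *)
From HB Require Import structures.
From mathcomp Require Import all_boot all_order all_algebra finmap.
From mathcomp Require Import all_classical all_reals all_analysis.

Set Implicit Arguments.
Unset Strict Implicit.
Unset Printing Implicit Defensive.

Import Order.TTheory GRing.Theory Num.Theory.
Local Open Scope ring_scope.

Record grid_graph (d : nat) := GridGraph {
  vertices : {fset 'rV[nat]_d};
  edges : {fset {fset 'rV[nat]_d}};
  (* the coordinates are in {1, 2, 3, ...} *)
  vertices_pos : forall v : 'rV[nat]_d, v \in vertices -> forall i, (0 < v ord0 i)%N;
  edges_sub : forall e, e \in edges -> (e `<=` vertices)%fset;
  edges_card : forall e, e \in edges -> #|` e|%fset = 2%N }.

Section Volume.
Variables (d : nat) (G : grid_graph d).

Definition in_grid (X : 'I_d -> nat) (v : 'rV[nat]_d) : Prop :=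
  forall i, (0 < v ord0 i <= X i)%N.

(* Grids are anchored at (1, ..., 1) and have positive side lengths, hence the
   maximum with 1, which only matters when there are no vertices. *)
Definition side (i : 'I_d) : nat := maxn 1 (\max_(v <- vertices G) v ord0 i).

Lemma side_minimal (X : 'I_d -> nat) : (forall i, 0 < X i)%N ->
  (forall v, v \in vertices G -> in_grid X v) <->
  (forall i, side i <= X i)%N.
Proof.
move=> X0; split=> [VX i|sX v vV i].
  rewrite geq_max X0 /=; apply/bigmax_leqP_seq => v vV _.
  by have /andP[] := VX v vV i.
rewrite (vertices_pos vV) /=; apply: leq_trans (sX i).
by rewrite leq_max orbC (@leq_bigmax_seq _ _ predT (fun w : 'rV[nat]_d => w ord0 i)).
Qed.

Definition vol : nat := \prod_(i < d) side i.

End Volume.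

Section Crossings.
Variables (R : realType) (d : nat).

Definition to_real (v : 'rV[nat]_d) : 'rV[R]_d := map_mx (fun n => n%:R) v.

Definition open_segment (u w : 'rV[R]_d) : set 'rV[R]_d :=
  [set x | exists2 t : R, 0 < t < 1 & x = (1 - t) *: u + t *: w].

Definition segment (e : {fset 'rV[nat]_d}) : set 'rV[R]_d :=
  [set x | exists u w, e = [fset u; w]%fset /\
                       open_segment (to_real u) (to_real w) x].

Definition proper_grid_graph (G : grid_graph d) : Prop :=
  forall e v, e \in edges G -> v \in vertices G -> ~ segment e (to_real v).

Definition cross (e f : {fset 'rV[nat]_d}) : Prop :=
  e != f /\ (segment e `&` segment f !=set0)%classic.

Definition crossings (G : grid_graph d) : {fset {fset {fset 'rV[nat]_d}}} :=
  [fset p in fpowerset (edges G) |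
     `[< exists e f, p = [fset e; f]%fset /\ cross e f >]]%fset.

Definition cr (G : grid_graph d) : nat := #|` crossings G|%fset.

Definition cr_set (N m : nat) : set (\bar R) :=
  [set ((cr G)%:R)%:E | G in [set G : grid_graph d |
     [/\ proper_grid_graph G, #|` edges G|%fset = m & (vol G <= N)%N]]]%classic.

Definition min_cr (N m : nat) : \bar R := ereal_inf (cr_set N m).

(* The infimum is a minimum, except that it is +oo on the empty set. *)
Lemma min_cr_attained (N m : nat) :
  (cr_set N m !=set0)%classic -> cr_set N m (min_cr N m).
Proof.
move=> [_ [G0 G0P _]].
pose P k := `[< exists2 G : grid_graph d,
  [/\ proper_grid_graph G, #|` edges G|%fset = m & (vol G <= N)%N] & cr G = k >].
have exP : exists k, P k by exists (cr G0); apply/asboolP; exists G0.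
case: (ex_minnP exP) => k /asboolP[G GP Gk] kmin.
suff -> : min_cr N m = (k%:R)%:E by exists G => //; rewrite Gk.
apply/eqP; rewrite eq_le; apply/andP; split.
  by apply: ereal_inf_lbound; exists G => //; rewrite Gk.
apply: le_ereal_inf_tmp => _ [H HP <-]; rewrite lee_fin ler_nat.
by apply: kmin; apply/asboolP; exists H.
Qed.

Lemma min_cr_empty (N m : nat) :
  cr_set N m = set0%classic -> min_cr N m = +oo%E.
Proof. by rewrite /min_cr => ->; rewrite ereal_inf0. Qed.

End Crossings.

(* Main.v *)
Require Import Defs.
From mathcomp Require Import all_boot all_order all_algebra finmap cyclic.
From mathcomp Require Import all_classical all_reals all_analysis.
From mathcomp Require Import zify ring lra.

Set Implicit Arguments.
Unset Strict Implicit.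
Unset Printing Implicit Defensive.

Import Order.TTheory GRing.Theory Num.Theory.
Local Open Scope ring_scope.

(** Why the bound holds.  Cut every edge by its points of parameter i / k, with
    i coprime to k.  For a fixed k this gives m phi(k) incidences between edges
    and points, and all these points, scaled by k, are lattice points of a box
    of volume k^3 N.  Cauchy-Schwarz then yields at least
    (m phi(k))^2 / (k^3 N) - m phi(k) ordered pairs of distinct edges that meet
    at points of denominator k on both ([meetings_ge]).  In a proper graph two
    edges have at most one common point ([edges_meet_once]), and a reduced
    fraction determines its denominator, so that no crossing is counted for two
    values of k ([sum_meetings_le]).  The estimates therefore add up over k.

    With K the integer part of sqrt (m / N), summing over k <= K gives a main
    term (m^2 / N) * sum phi(k)^2 / k^3, a loss of at most m K^2 <= m^2 / N, and
    the sum of the phi(k)^2 / k^3 is at least a quarter of the harmonic sum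
    ([harmonic_sum_le_totient_sqr]), hence at least ln (m / N) / 8.  This proves
    the theorem as soon as m / N exceeds an absolute constant ([crossings_log]).

    For smaller values of m / N the logarithm is bounded and a number of
    crossings linear in m is enough ([crossings_linear]).  It comes from the
    midpoints k = 2 alone, but the count above is too weak at m = 8 N, because
    there are about 8 N points with half-integral coordinates.  The remedy is to
    replace each edge by a subsegment with lattice ends whose midpoint is not
    a lattice point ([odd_subsegment]): this leaves 7 N possible midpoints,
    fewer than the number of edges by a constant factor. *)

(** * Coincidences of a map into a box *)

Lemma sqr_sum_le (B : finType) (D : {pred B}) (n : B -> nat) :
  ((\sum_(b in D) n b) ^ 2 <= #|D| * \sum_(b in D) n b ^ 2)%N.
Proof.
rewrite -(leq_pmul2l (m := 2)) // -mulnn big_distrlr /= big_distrr /=.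
apply: (@leq_trans (\sum_(b in D) \sum_(c in D) (n b ^ 2 + n c ^ 2))%N).
  apply: leq_sum => b _; rewrite big_distrr /=; apply: leq_sum => c _.
  by rewrite (nat_Cauchy (n b) (n c)).
under eq_bigr => b _ do rewrite big_split /= sum_nat_const.
by rewrite big_split /= sum_nat_const -big_distrr /= addnn mul2n.
Qed.

(** Cauchy-Schwarz applied to the sizes of the fibres of f.  The pairs on the
    diagonal are counted too. *)
Lemma card_coincidences (A B : finType) (S : {pred A}) (D : {pred B})
    (f : A -> B) : {in S, forall a, f a \in D} ->
  (#|S| ^ 2 <= #|D| * #|[pred p : A * A |
     [&& p.1 \in S, p.2 \in S & f p.1 == f p.2]]|)%N.
Proof.
move=> fD; pose n b := #|[pred a in S | f a == b]|.
have cardS : #|S| = (\sum_(b in D) n b)%N.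
  rewrite -sum1_card (partition_big f (mem D)) //=.
  by apply: eq_bigr => b _; rewrite /n -sum1_card; apply: eq_bigl.
have -> : #|[pred p : A * A | [&& p.1 \in S, p.2 \in S & f p.1 == f p.2]]|
    = (\sum_(b in D) n b ^ 2)%N.
  rewrite -sum1_card (eq_bigl (fun p : A * A =>
    (p.1 \in S) && ((p.2 \in S) && (f p.2 == f p.1)))); last first.
    by move=> p; rewrite inE [f p.2 == _]eq_sym.
  rewrite -(pair_big_dep (mem S) (fun a a' => (a' \in S) && (f a' == f a))
    (fun _ _ => 1%N)) /=.
  rewrite (partition_big f (mem D)) //=; apply: eq_bigr => b _.
  rewrite -mulnn -[X in (X * _)%N]sum1_card big_distrl /=.
  apply: eq_bigr => a /andP[_ /eqP <-]; rewrite mul1n /n -sum1_card.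
  exact: eq_bigl.
by rewrite cardS sqr_sum_le.
Qed.

(** The case c = 1 counts all the points of an interval, the case c = 2 the even
    ones.  M only has to be large enough for the interval to fit in 'I_M.+1. *)
Lemma card_multiples (M c X : nat) : (0 < c)%N -> (c * X <= M)%N ->
  #|[pred x : 'I_M.+1 | (0 < x <= c * X)%N && (c %| x)%N]| = X.
Proof.
move=> c0 cXM; pose g (i : 'I_X) : 'I_M.+1 := inord (c * i.+1).
have gE i : g i = (c * i.+1)%N :> nat.
  by rewrite inordK // ltnS (leq_trans _ cXM) // leq_mul2l ltn_ord orbT.
rewrite -[RHS]card_ord -(card_codom (f := g)); last first.
  move=> i i' /(congr1 val); rewrite /= !gE => /eqP.
  by rewrite eqn_pmul2l // => /eqP[/val_inj].
apply: eq_card => x; rewrite inE; apply/idP/codomP => [|[i ->]]; last first.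
  by rewrite gE muln_gt0 c0 leq_mul2l ltn_ord orbT dvdn_mulr.
case/andP=> /andP[x0 xX] /dvdnP[q xq]; move: x0 xX.
rewrite xq mulnC leq_pmul2l // muln_gt0 c0 /= => q0 qX.
have qX' : (q.-1 < X)%N by rewrite prednK.
by exists (Ordinal qX'); apply: val_inj; rewrite /= gE /= prednK // xq mulnC.
Qed.

Lemma card_box (d M c : nat) (X : 'I_d -> nat) : (0 < c)%N ->
    (forall j, (c * X j <= M)%N) ->
  #|[pred x : {ffun 'I_d -> 'I_M.+1} |
     [forall j, (0 < x j <= c * X j)%N && (c %| x j)%N]]| = (\prod_j X j)%N.
Proof.
move=> c0 cXM; pose F (j : 'I_d) := [pred x : 'I_M.+1 | (0 < x <= c * X j)%N && (c %| x)%N].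
rewrite (eq_card (B := family F)); last by move=> x; rewrite !inE.
rewrite card_family foldrE big_map big_enum /=.
by apply: eq_bigr => j _; rewrite card_multiples.
Qed.

(** In the box of sides 2 X_j, removing the points with even coordinates, which
    are a copy of the box of sides X_j, leaves a fraction 1 - 2^-d. *)
Lemma card_odd_box (d M : nat) (X : 'I_d -> nat) :
    (forall j, (2 * X j <= M)%N) ->
  #|[pred x : {ffun 'I_d -> 'I_M.+1} |
     [forall j, (0 < x j <= 2 * X j)%N] && [exists j, odd (x j)]]|
  = ((2 ^ d).-1 * \prod_j X j)%N.
Proof.
move=> XM; set P := LHS.
have XM1 j : (1 * (2 * X j) <= M)%N by rewrite mul1n.
have := cardID [pred x : {ffun 'I_d -> 'I_M.+1} | [exists j, odd (x j)]]
  [pred x : {ffun 'I_d -> 'I_M.+1} | [forall j, (0 < x j <= 1 * (2 * X j))%N && (1 %| x j)%N]].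
rewrite (card_box _ XM1) // big_split /= prod_nat_const card_ord.
rewrite [X in (X + _)%N](_ : _ = P); last first.
  apply: eq_card => x; rewrite !inE; congr (_ && _).
  by apply: eq_forallb => j; rewrite dvd1n mul1n andbT.
rewrite [X in (_ + X)%N](_ : _ = \prod_j X j)%N.
  by move=> e; rewrite -subn1 mulnBl mul1n -e addnK.
rewrite -(card_box (M := M) (c := 2)) //; apply: eq_card => x; rewrite !inE.
rewrite negb_exists; apply/andP/forallP => [[/forallP a /forallP b] j|h].
  by have := a j; have := b j; rewrite dvdn2 mul1n dvd1n andbT => a1 b1; apply/andP.
split; apply/forallP => j; have := h j; rewrite dvdn2 ?mul1n ?dvd1n ?andbT.
  by case/andP.
by case/andP.
Qed.

(** * Points dividing segments in rational ratios *)

(** The point of parameter i / k on the segment from u to v, multiplied by k so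
    that it is a lattice point. *)
Definition division_point (d k i : nat) (u v : 'rV[nat]_d) : {ffun 'I_d -> nat} :=
  [ffun j => ((k - i) * u ord0 j + i * v ord0 j)%N].

(** Ordered pairs, so that every unordered pair of segments appears twice.  The
    bound K makes the type independent of k, which allows summing over k. *)
Definition meetings (I : finType) (d K k : nat) (u v : I -> 'rV[nat]_d) :=
  [pred p : (I * 'I_K.+1) * (I * 'I_K.+1) |
    [&& p.1.1 != p.2.1,
        (p.1.2 < k)%N && coprime k p.1.2, (p.2.2 < k)%N && coprime k p.2.2 &
        division_point k p.1.2 (u p.1.1) (v p.1.1) ==
        division_point k p.2.2 (u p.2.1) (v p.2.1)]].

Lemma card_coprime_below (K k : nat) : (k <= K)%N ->
  #|[pred i : 'I_K.+1 | (i < k)%N && coprime k i]| = totient k.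
Proof.
move=> kK; rewrite totient_count_coprime big_mkord.
rewrite (big_ord_widen K.+1 (fun i => nat_of_bool (coprime k i))) ?(leqW kK) //.
rewrite -sum1_card big_mkcond [RHS]big_mkcond /=; apply: eq_bigr => i _.
by rewrite inE; case: (i < k)%N => /=; case: (coprime k i).
Qed.

Lemma division_point_inj (d k i i' : nat) (u v : 'rV[nat]_d) :
  u != v -> (i <= k)%N -> (i' <= k)%N ->
  division_point k i u v = division_point k i' u v -> i = i'.
Proof.
move=> uv ik ik' /ffunP e; apply/eqP; apply: contraNT uv => ii'.
apply/eqP/rowP => j; have := e j; rewrite !ffunE.
move: ik ik' ii'; set a := u _ _; set b := v _ _ => ik ik' ii' h.
nia.
Qed.

(** On a single segment the division points are pairwise distinct, hence the
    coincidences between a segment and itself are exactly the #|I| * totient k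
    diagonal ones; all the others are meetings.  D is any set known to contain
    the division points: a smaller D gives a better bound. *)
Lemma meetings_ge (I : finType) (d K k M : nat) (u v : I -> 'rV[nat]_d)
    (D : {pred {ffun 'I_d -> 'I_M.+1}}) :
  (k <= K)%N -> (forall e, u e != v e) ->
  (forall e i j, (i < k)%N -> (division_point k i (u e) (v e) j <= M)%N) ->
  (forall e i, (i < k)%N -> coprime k i ->
     [ffun j => inord (division_point k i (u e) (v e) j)] \in D) ->
  ((#|I| * totient k) ^ 2 <=
     #|D| * (#|meetings K k u v| + #|I| * totient k))%N.
Proof.
move=> kK uv ptM ptD.
pose S := [pred a : I * 'I_K.+1 | (a.2 < k)%N && coprime k a.2].
have cardS : #|S| = (#|I| * totient k)%N.
  rewrite -(card_coprime_below kK) -cardX; apply: eq_card => -[e i].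
  by rewrite !inE.
pose f (a : I * 'I_K.+1) : {ffun 'I_d -> 'I_M.+1} :=
  [ffun j => inord (division_point k a.2 (u a.1) (v a.1) j)].
have fD : {in S, forall a, f a \in D} by move=> [e i] /andP[ik ci]; exact: ptD.
have fE a b : a \in S -> b \in S -> (f a == f b) =
  (division_point k a.2 (u a.1) (v a.1) == division_point k b.2 (u b.1) (v b.1)).
  case: a b => [e i] [e' i'] /andP[/= ik _] /andP[/= ik' _].
  apply/eqP/eqP => [/ffunP h|/ffunP h]; apply/ffunP => j; have := h j; rewrite !ffunE.
    by move/(congr1 val) => /=; rewrite !inordK ?ltnS //;
      [have := ptM e' i' j ik' | have := ptM e i j ik]; rewrite ffunE.
  by move=> ->.
have := card_coincidences fD; rewrite cardS => /leq_trans; apply.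
rewrite leq_mul2l; apply/orP; right.
pose diag := [pred p : (I * 'I_K.+1) * (I * 'I_K.+1) | (p.1 \in S) && (p.1 == p.2)].
have -> : (#|I| * totient k = #|diag|)%N.
  rewrite -cardS -(card_in_imset (f := fun a => (a, a)) (D := S)); last first.
    by move=> a b _ _ [].
  apply: eq_card => -[a b]; rewrite !inE /=; apply/imsetP/andP => [[c cS [-> ->]]|].
    by split.
  by move=> [aS /eqP <-]; exists a.
(* every coincidence is a meeting or lies on the diagonal *)
rewrite -cardUI (leq_trans _ (leq_addr _ _)) //.
apply/subset_leq_card/fintype.subsetP => -[[e i] [e' i']].
rewrite !inE /= => /and3P[/andP[ik ci] /andP[ik' ci'] fab].
have := fE (e, i) (e', i'); rewrite !inE /= ik ci ik' ci' => /(_ isT isT) fE'.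
move: fab; rewrite fE' => fab; rewrite fab !andbT /=.
case: eqVneq => //= ee'; subst e'; rewrite xpair_eqE eqxx /=.
by apply/eqP/val_inj; apply: (division_point_inj (uv e) (ltnW ik) (ltnW ik')); apply/eqP.
Qed.

(** When two segments can only meet once, and at points with determined reduced
    parameters, forgetting the parameters is injective on all the meetings, for
    all denominators together. *)
Lemma sum_meetings_le (I : finType) (d K : nat) (u v : I -> 'rV[nat]_d)
    (O : {pred I * I}) :
  (forall k i i' e e', (i < k)%N -> (i' < k)%N -> coprime k i -> coprime k i' ->
     (1 < k)%N -> e != e' ->
     division_point k i (u e) (v e) = division_point k i' (u e') (v e') ->
     (e, e') \in O) ->
  (forall k i i' l j j' e e', (1 < k)%N -> (1 < l)%N ->
     (i < k)%N -> (i' < k)%N -> coprime k i -> coprime k i' ->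
     (j < l)%N -> (j' < l)%N -> coprime l j -> coprime l j' -> e != e' ->
     division_point k i (u e) (v e) = division_point k i' (u e') (v e') ->
     division_point l j (u e) (v e) = division_point l j' (u e') (v e') ->
     [/\ k = l, i = j & i' = j']) ->
  (\sum_(2 <= k < K.+1) #|meetings K k u v| <= #|O|)%N.
Proof.
move=> mO muniq.
pose T := [pred q : 'I_K.+1 * ((I * 'I_K.+1) * (I * 'I_K.+1)) |
  (1 < q.1)%N && (q.2 \in meetings K q.1 u v)].
have -> : (\sum_(2 <= k < K.+1) #|meetings K k u v| = #|T|)%N.
  rewrite big_geq_mkord -sum1_card.
  rewrite -(pair_big_dep (fun k : 'I_K.+1 => (1 < k)%N)
    (fun (k : 'I_K.+1) p => p \in meetings K k u v) (fun _ _ => 1%N)) /=.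
  by apply: eq_bigr => k _; rewrite sum1_card.
pose g (q : 'I_K.+1 * ((I * 'I_K.+1) * (I * 'I_K.+1))) := (q.2.1.1, q.2.2.1).
rewrite -(card_in_imset (f := g) (D := T)).
  apply/subset_leq_card/fintype.subsetP => _ /imsetP[[k [[e i] [e' i']]] + ->].
  rewrite !inE /= => /andP[k1 /and4P[ee' /andP[ik ci] /andP[ik' ci'] /eqP h]].
  exact: mO h.
move=> [k [[e i] [e' i']]] [l [[f j] [f' j']]]; rewrite !inE /g /=.
move=> /andP[k1 /and4P[ee' /andP[ik ci] /andP[ik' ci'] /eqP h]].
move=> /andP[l1 /and4P[ff' /andP[jl cj] /andP[jl' cj'] /eqP h']] [ef ef'].
subst f f'.
have [kl ij ij'] := muniq _ _ _ _ _ _ _ _ k1 l1 ik ik' ci ci' jl jl' cj cj' ee' h h'.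
by rewrite (val_inj kl) (val_inj ij) (val_inj ij').
Qed.

(** * Sums of totients *)

Definition harmonic_sum (R : realType) (K : nat) : R := \sum_(1 <= k < K.+1) k%:R^-1.

Lemma ln_le_harmonic_sum (R : realType) (K : nat) :
  ln (K.+1%:R : R) <= harmonic_sum R K.
Proof.
elim: K => [|K IH]; first by rewrite ln1 /harmonic_sum big_geq.
rewrite /harmonic_sum big_nat_recr //= -/(harmonic_sum R K).
have K0 : 0 < K.+1%:R :> R by rewrite ltr0n.
have -> : K.+2%:R = K.+1%:R * (1 + K.+1%:R^-1) :> R.
  by rewrite mulrDr mulr1 mulfV ?gt_eqF // -natr1.
have i0 : 0 < K.+1%:R^-1 :> R by rewrite invr_gt0.
rewrite lnM ?posrE ?addr_gt0 // lerD // le_ln1Dx //.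
by apply: lt_trans i0; rewrite oppr_lt0.
Qed.

Lemma sum_inv_sqr_le (R : realType) (K : nat) :
  \sum_(1 <= k < K.+1) (k%:R^-1 ^+ 2 : R) <= 2.
Proof.
case: K => [|K]; first by rewrite big_geq.
suff : \sum_(1 <= k < K.+2) (k%:R^-1 ^+ 2 : R) <= 2 - K.+1%:R^-1.
  by move/le_trans; apply; rewrite gerBl invr_ge0.
elim: K => [|K IH]; first by rewrite big_nat1 invr1; lra.
rewrite big_nat_recr //=; apply: le_trans (lerD IH (lexx _)) _.
have x0 : 0 < K.+1%:R :> R by rewrite ltr0n.
have -> : K.+2%:R = K.+1%:R + 1 :> R by rewrite -natr1.
move: x0; set x : R := K.+1%:R => x0.
have x10 : 0 < x + 1 by lra.
have -> : 2 - (x + 1)^-1 = 2 - x^-1 + x^-1 * (x + 1)^-1.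
  by field; rewrite !gt_eqF.
by rewrite lerD2l expr2 ler_wpM2r ?invr_ge0 1?ltW // ltf_pV2 ?posrE //; lra.
Qed.

(** By induction on K, as K %/ d grows by one exactly at the multiples of d. *)
Lemma sum_multiples_inv_sqr (R : realType) (K d : nat) : (0 < d)%N ->
  \sum_(1 <= k < K.+1 | (d %| k)%N) (k%:R^-1 ^+ 2 : R) =
  d%:R^-1 ^+ 2 * \sum_(1 <= j < (K %/ d).+1) j%:R^-1 ^+ 2.
Proof.
move=> d0; elim: K => [|K IH]; first by rewrite div0n !big_geq // mulr0.
rewrite big_mkcond big_nat_recr //= -big_mkcond IH divnS //.
case: (boolP (d %| K.+1)%N) => dK; last by rewrite addr0 add0n.
rewrite add1n [in RHS]big_nat_recr //= mulrDr; congr (_ + _).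
have dE := divnS K d0; rewrite dK add1n in dE.
by rewrite -dE -exprMn -invfM -natrM mulnC divnK.
Qed.

Lemma sum_totient_divisors (k K : nat) : (0 < k <= K)%N ->
  (\sum_(1 <= d < K.+1 | d %| k) totient d = k)%N.
Proof.
case/andP=> k0 kK; rewrite -[RHS]sum_totient_dvd big_geq_mkord.
rewrite (big_ord_widen_cond K.+1 (fun d => d %| k)%N totient) //.
apply: eq_bigl => d; case: (boolP (d %| k)%N) => //= dk.
by rewrite ltnS (dvdn_gt0 k0 dk) dvdn_leq.
Qed.

(** Write 1 / k as k / k^2, and the numerator k as the sum of phi(d) over the
    divisors d of k.  After exchanging the sums, d contributes phi(d) / d^2 times
    a partial sum of the inverse squares, which is at most 2. *)
Lemma harmonic_sum_le_totient (R : realType) (K : nat) :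
  harmonic_sum R K <= 2 * \sum_(1 <= k < K.+1) (totient k)%:R * k%:R^-1 ^+ 2.
Proof.
have -> : harmonic_sum R K = \sum_(1 <= d < K.+1)
    (totient d)%:R * \sum_(1 <= k < K.+1 | (d %| k)%N) k%:R^-1 ^+ 2.
  under [RHS]eq_bigr => d _ do rewrite big_distrr /= big_mkcond /=.
  rewrite exchange_big_nat /=; apply: eq_big_nat => k /andP[k0 kK].
  rewrite [LHS](_ : _ = k%:R * k%:R^-1 ^+ 2); last first.
    by rewrite expr2 mulrA mulfV ?mul1r // pnatr_eq0 -lt0n.
  rewrite -big_mkcond -big_distrl /= -natr_sum sum_totient_divisors //.
  by rewrite k0.
rewrite big_distrr /= big_nat [leRHS]big_nat; apply: ler_sum => d /andP[d0 _].
rewrite sum_multiples_inv_sqr // mulrA [leRHS]mulrC.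
by rewrite ler_wpM2l ?mulr_ge0 ?exprn_ge0 ?invr_ge0 // sum_inv_sqr_le.
Qed.

(** Termwise: with y = phi(k) / k, from (2 y - 1)^2 >= 0 follows 4 y^2 >= 4 y - 1,
    and the sum of the (4 y - 1) / k is at least the harmonic sum by
    [harmonic_sum_le_totient]. *)
Lemma harmonic_sum_le_totient_sqr (R : realType) (K : nat) :
  harmonic_sum R K <= 4 * \sum_(1 <= k < K.+1) (totient k)%:R ^+ 2 * k%:R^-1 ^+ 3.
Proof.
suff : 2 * (2 * \sum_(1 <= k < K.+1) (totient k)%:R * k%:R^-1 ^+ 2) - harmonic_sum R K
    <= 4 * \sum_(1 <= k < K.+1) (totient k)%:R ^+ 2 * k%:R^-1 ^+ 3.
  by apply: le_trans; have := harmonic_sum_le_totient R K; lra.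
rewrite mulrA !big_distrr -sumrB /= big_nat [leRHS]big_nat.
apply: ler_sum => k /andP[k0 _].
have x0 : 0 < k%:R^-1 :> R by rewrite invr_gt0 ltr0n.
move: x0; set x : R := k%:R^-1; set a : R := (totient k)%:R => x0.
rewrite -subr_ge0.
have -> : 4 * (a ^+ 2 * x ^+ 3) - (2 * 2 * (a * x ^+ 2) - x) = x * (2 * a * x - 1) ^+ 2.
  by ring.
by rewrite mulr_ge0 ?sqr_ge0 // ltW.
Qed.

(** * Edges of a proper grid graph *)

Lemma open_segmentC (R : realType) (d : nat) (a b x : 'rV[R]_d) :
  open_segment a b x -> open_segment b a x.
Proof.
case=> t /andP[t0 t1] ->; exists (1 - t); first by lra.
by rewrite subKr addrC.
Qed.

Lemma fset2_eq (T : choiceType) (a b c e : T) :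
  [fset a; b]%fset = [fset c; e]%fset -> (a, b) = (c, e) \/ (a, b) = (e, c).
Proof.
move=> /fsetP h; have := h a; have := h b; have := h c; have := h e.
rewrite !inE !eqxx !orbT /= => + + /esym + /esym.
move=> he hc /orP[/eqP ?|/eqP ?] /orP[/eqP ?|/eqP ?]; subst; auto.
  by left; move: he; rewrite orbb => /eqP ->.
by left; move: hc; rewrite orbb => /eqP ->.
Qed.

Lemma segmentE (R : realType) (d : nat) (a b : 'rV[nat]_d) (x : 'rV[R]_d) :
  segment [fset a; b]%fset x <-> open_segment (to_real R a) (to_real R b) x.
Proof.
split=> [[u [w [ab xuw]]]|xab]; last by exists a, b.
by have [[-> ->]|[-> ->]] := fset2_eq ab => //; apply: open_segmentC.
Qed.

(** The positive factor r says that the two segments lie on parallel lines with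
    the same orientation, and the common point that the lines coincide.  Two
    overlapping intervals of a line, none of which contains an end of the other
    in its interior, have the same ends. *)
Lemma collinear_segments_eq (R : realType) (d : nat) (a b c e : 'rV[R]_d) (r s t : R) :
  0 < r -> e - c = r *: (b - a) -> 0 < s < 1 -> 0 < t < 1 ->
  (1 - s) *: a + s *: b = (1 - t) *: c + t *: e ->
  ~ open_segment a b c -> ~ open_segment a b e ->
  ~ open_segment c e a -> ~ open_segment c e b -> a = c /\ b = e.
Proof.
move=> r0 ec /andP[s0 s1] /andP[t0 t1] st Nc Ne Na Nb.
(* On the line through a and b, parametrised by a = 0 and b = 1,
   c is at z and e at z + r. *)
have [z zE] : exists z, z = s - t * r by exists (s - t * r).
have cE : c = (1 - z) *: a + z *: b.
  apply/rowP => j; move/rowP/(_ j): ec; move/rowP/(_ j): st; rewrite !mxE zE.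
  move: (a _ _) (b _ _) (c _ _) (e _ _) => aj bj cj ej h1 h2.
  have : t * (ej - cj) = t * (r * (bj - aj)) by rewrite h2.
  by lra.
have eE : e = (1 - (z + r)) *: a + (z + r) *: b.
  apply/rowP => j; move/rowP/(_ j): ec; move/rowP/(_ j): cE; rewrite !mxE.
  by move: (a _ _) (b _ _) (c _ _) (e _ _) => aj bj cj ej -> h2; lra.
have tr0 : 0 < t * r by rewrite mulr_gt0.
have trr : t * r < r by rewrite gtr_pMl.
have reparam x y : (1 - y) * z + y * (z + r) = x ->
    (1 - x) *: a + x *: b = (1 - y) *: c + y *: e.
  move=> <-; apply/rowP => j; move/rowP/(_ j): eE; move/rowP/(_ j): cE.
  by rewrite !mxE => -> ->; ring.
have z0 : z = 0.
  apply/eqP; rewrite eq_le; apply/andP; split; rewrite leNgt; apply/negP => zlt.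
    by apply: Nc; exists z => //; rewrite zlt /=; lra.
  apply: Na; exists (- z / r).
    by rewrite divr_gt0 ?oppr_gt0 //= ltr_pdivrMr //; lra.
  rewrite -(reparam 0); first by rewrite subr0 scale1r scale0r addr0.
  by field; rewrite gt_eqF.
have r1 : r = 1.
  apply/eqP; rewrite eq_le; apply/andP; split; rewrite leNgt; apply/negP => rlt.
    apply: Nb; exists (1 / r).
      by rewrite divr_gt0 //= ltr_pdivrMr //; lra.
    rewrite -(reparam 1); first by rewrite subrr scale1r scale0r add0r.
    by rewrite z0; field; rewrite gt_eqF.
  by apply: Ne; exists (z + r) => //; rewrite z0; lra.
by rewrite cE eE z0 r1 add0r subr0 subrr !scale1r !scale0r addr0 add0r.
Qed.

Lemma to_real_inj (R : realType) (d : nat) : injective (@to_real R d).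
Proof.
move=> u v /rowP uv; apply/rowP => j; have := uv j; rewrite !mxE => /eqP.
by rewrite eqr_nat => /eqP.
Qed.

Lemma edge_ends (d : nat) (G : grid_graph d) (e : {fset 'rV[nat]_d}) :
  e \in edges G -> exists a b : 'rV[nat]_d,
    [/\ e = [fset a; b]%fset, a != b, a \in vertices G & b \in vertices G].
Proof.
move=> eG; have e2 := edges_card eG; have /fsubsetP sub := edges_sub eG.
have /fset0Pn[a ae] : e != fset0 by rewrite -cardfs_gt0 e2.
have : (#|` e `\ a| == 1)%fset by move: e2; rewrite (cardfsD1 a) ae add1n => -[->].
move=> /cardfs1P[b eab]; have eE : e = [fset a; b]%fset by rewrite -eab fsetD1K.
have ab : a != b by move: e2; rewrite eE cardfs2; case: eqVneq.
by exists a, b; split=> //; apply: sub; rewrite eE !inE eqxx ?orbT.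
Qed.

(** Two common points would make the edges collinear and overlapping, whereas no
    vertex lies inside an edge. *)
Lemma edges_meet_once (R : realType) (d : nat) (G : grid_graph d)
    (e f : {fset 'rV[nat]_d}) (p q : 'rV[R]_d) :
  proper_grid_graph R G -> e \in edges G -> f \in edges G -> e != f ->
  segment e p -> segment f p -> segment e q -> segment f q -> p = q.
Proof.
move=> prG eG fG ef pe pf qe qf; apply: contraNeq ef => pq.
have [a [b [eE _ aV bV]]] := edge_ends eG.
have [c [c' [fE _ cV c'V]]] := edge_ends fG.
have Nc := prG _ _ eG cV; have Nc' := prG _ _ eG c'V.
have Na := prG _ _ fG aV; have Nb := prG _ _ fG bV.
subst e f.
move: pe pf qe qf Nc Nc' Na Nb; rewrite !segmentE.
set A := to_real R a; set B := to_real R b.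
set C := to_real R c; set E := to_real R c'.
move=> [s s01 pE] [t t01 pE'] [s' _ qE] [t' _ qE'] Nc Nc' Na Nb.
have CE : (t' - t) *: (E - C) = (s' - s) *: (B - A).
  apply/rowP => j; move/rowP/(_ j): pE; move/rowP/(_ j): pE'.
  move/rowP/(_ j): qE; move/rowP/(_ j): qE'; rewrite !mxE.
  move: (p _ _) (q _ _) => ? ? ? ? ? ?; lra.
have tt' : t' - t != 0.
  by apply: contra_neq pq => /eqP; rewrite subr_eq0 pE' qE' => /eqP ->.
pose r := (s' - s) / (t' - t).
have rE : E - C = r *: (B - A).
  by rewrite /r mulrC -scalerA -CE scalerA mulVf // scale1r.
have r0 : r != 0.
  rewrite mulf_neq0 ?invr_neq0 //.
  by apply: contra_neq pq => /eqP; rewrite subr_eq0 pE qE => /eqP ->.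
have pp : (1 - s) *: A + s *: B = (1 - t) *: C + t *: E by rewrite -pE -pE'.
(* If the orientations differ, the ends of the second edge are exchanged. *)
move: r0; rewrite neq_lt => /orP[r0|r0].
  have t01' : 0 < 1 - t < 1 by lra.
  have [] := @collinear_segments_eq R d A B E C (- r) s (1 - t).
  - by rewrite oppr_gt0.
  - by rewrite scaleNr -rE opprB.
  - by [].
  - by [].
  - by rewrite pp subKr addrC.
  - by [].
  - by [].
  - by move=> /open_segmentC.
  - by move=> /open_segmentC.
  by move=> /to_real_inj -> /to_real_inj ->; rewrite fsetUC.
have [] := collinear_segments_eq r0 rE s01 t01 pp Nc Nc' Na Nb.
by move=> /to_real_inj -> /to_real_inj ->.
Qed.

(** As long as the midpoint of a and b is a lattice point, it can replace b.  This
    halves all the coordinate differences, so it stops before b reaches a. *)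
Lemma odd_subsegment (R : realType) (d : nat) (a b : 'rV[nat]_d) : a != b ->
  (forall j, (0 < a ord0 j)%N) -> (forall j, (0 < b ord0 j)%N) ->
  exists v : 'rV[nat]_d,
    [/\ a != v, exists j, odd (a ord0 j + v ord0 j),
        forall j, (0 < v ord0 j <= maxn (a ord0 j) (b ord0 j))%N &
        (open_segment (to_real R a) (to_real R v) `<=`
         open_segment (to_real R a) (to_real R b))%classic].
Proof.
move=> + a0.
have [n] : exists n, forall j, (a ord0 j < b ord0 j + 2 ^ n)%N /\
                              (b ord0 j < a ord0 j + 2 ^ n)%N.
  exists (\sum_j (a ord0 j + b ord0 j))%N => j.
  have := ltn_expl (\sum_j (a ord0 j + b ord0 j))%N (isT : (1 < 2)%N).
  have : (a ord0 j + b ord0 j <= \sum_j (a ord0 j + b ord0 j))%N.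
    by rewrite [leqRHS](bigD1 j) //= leq_addr.
  by move: (\sum_j _)%N (2 ^ _)%N => *; lia.
elim: n b => [|n IH] b close ab b0.
  by case/negP: ab; apply/eqP/rowP => j;
     change (a ord0 j = b ord0 j); have [] := close j; rewrite expn0; lia.
have [[j oj]|even] := pselect (exists j, odd (a ord0 j + b ord0 j)).
  exists b; split=> //; first by exists j.
  by move=> i; rewrite b0 leq_maxr.
have {}even j : exists q, (a ord0 j + b ord0 j = 2 * q)%N.
  exists (a ord0 j + b ord0 j)./2; rewrite mul2n even_halfK //.
  by apply/negP => oj; apply: even; exists j.
have [c cE] : exists c : 'rV[nat]_d, forall j, (a ord0 j + b ord0 j = 2 * c ord0 j)%N.
  exists (\row_j (a ord0 j + b ord0 j)./2) => j.
  by have [q qE] := even j; rewrite mxE qE mul2n doubleK mul2n.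
have [|||v [av oddv vb sub]] := IH c.
- by move=> j; have := cE j; have := close j; rewrite expnS; lia.
- apply: contra_neq ab => ac; apply/rowP => j;
    change (a ord0 j = b ord0 j); have := cE j; rewrite -ac; lia.
- by move=> j; have := cE j; have := a0 j; have := b0 j; lia.
exists v; split=> //.
  by move=> j; have := vb j; have := cE j; lia.
move=> x /sub[t t01 ->]; exists (t / 2); first lra.
apply/rowP => j; rewrite !mxE.
have /(congr1 (fun n => n%:R : R)) := cE j; rewrite natrD natrM.
move: (a _ _)%:R (b _ _)%:R (c _ _)%:R => aj bj cj abc.
by have -> : cj = (aj + bj) / 2 by [lra]; field.
Qed.

(** The fibres of h have at most two elements, a and sw a.  A partial h allows
    for values that are only known to lie in B on O. *)
Lemma card_le_double (A B : finType) (O : {pred A}) (h : A -> option B) (sw : A -> A) :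
  (forall a, a \in O -> h a != None) ->
  (forall a b c, h a = Some c -> h b = Some c -> b = a \/ b = sw a) ->
  (#|O| <= 2 * #|B|)%N.
Proof.
move=> hO hsw; rewrite -sum1_card (partition_big h (predC1 None)) //=.
apply: (@leq_trans (\sum_(c | c != None :> option B) 2)%N); last first.
  by rewrite sum_nat_const cardC1 card_option mulnC.
apply: leq_sum => -[c|] // _; rewrite sum1_card.
have [e0|/card_gt0P[a /andP[_ /eqP ha]]] := posnP #|[pred p in O | h p == Some c]|.
  by rewrite [X in (X <= _)%N]e0.
apply: (@leq_trans #|pred2 a (sw a)|); last by rewrite card2; case: eqP.
apply/subset_leq_card/fintype.subsetP => b /andP[_ /eqP hb].
by have [->|->] := hsw _ _ _ ha hb; rewrite !inE eqxx ?orbT.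
Qed.

(** Each crossing, as a set of two edges, comes from at most two ordered pairs. *)
Lemma ordered_crossings_le (R : realType) (d : nat) (G : grid_graph d) :
  (#|[pred p : edges G * edges G | `[< cross R (val p.1) (val p.2) >]]|
     <= 2 * cr R G)%N.
Proof.
pose h (p : edges G * edges G) : option (crossings R G) :=
  insub [fset val p.1; val p.2]%fset.
have valh p c : h p = Some c -> val c = [fset val p.1; val p.2]%fset.
  by rewrite /h; case: insubP => // ? _ <- [->].
rewrite /cr cardfE.
apply: (card_le_double (h := h) (sw := fun p => (p.2, p.1))) => [p|].
  move=> /asboolP cp; rewrite /h insubT //.
  rewrite !inE /=; apply/andP; split.
    by rewrite fpowersetE; apply/fsubsetP => x; rewrite !inE => /orP[]/eqP ->;
      apply: fsvalP.
  by apply/asboolP; exists (val p.1), (val p.2).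
move=> [e f] [e' f'] c /valh /= ec /valh /= ec'; rewrite ec in ec'.
by have [[/val_inj -> /val_inj ->]|[/val_inj -> /val_inj ->]] := fset2_eq (esym ec'); auto.
Qed.

Lemma odd_subsegments (R : realType) (d : nat) (G : grid_graph d) :
  exists u v : edges G -> 'rV[nat]_d, forall e : edges G,
    [/\ u e != v e, exists j, odd (u e ord0 j + v e ord0 j),
        forall j, (0 < u e ord0 j <= side G j)%N /\ (0 < v e ord0 j <= side G j)%N &
        (open_segment (to_real R (u e)) (to_real R (v e)) `<=` segment (val e))%classic].
Proof.
have ex (e : edges G) : exists w : 'rV[nat]_d * 'rV[nat]_d,
    [/\ w.1 != w.2, exists j, odd (w.1 ord0 j + w.2 ord0 j),
        forall j, (0 < w.1 ord0 j <= side G j)%N /\ (0 < w.2 ord0 j <= side G j)%N &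
        (open_segment (to_real R w.1) (to_real R w.2) `<=` segment (val e))%classic];
  last by have [w wP] := boolp.choice ex; exists (fst \o w), (snd \o w).
have [a [b [eE ab aV bV]]] := edge_ends (valP e).
have side0 j : (0 < side G j)%N by rewrite leq_maxl.
have bound x : x \in vertices G -> forall j, (0 < x ord0 j <= side G j)%N.
  by move=> xV; apply: (side_minimal G side0).2 => // j; rewrite leqnn.
have pos x : x \in vertices G -> forall j, (0 < x ord0 j)%N.
  by move=> xV j; have /andP[] := bound _ xV j.
have [v [av oddv vb sub]] := @odd_subsegment R d a b ab (pos _ aV) (pos _ bV).
exists (a, v); split=> //= [j|x /sub]; last by rewrite -segmentE -eE.
split; first exact: bound.
have /andP[-> /leq_trans->//] := vb j; rewrite geq_max.
by have /andP[_ ->] := bound _ aV j; have /andP[_ ->] := bound _ bV j.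
Qed.

(** * Counting crossings by denominators *)

Definition barycenter (R : realType) (d : nat) (t : R) (u v : 'rV[nat]_d) : 'rV[R]_d :=
  (1 - t) *: to_real R u + t *: to_real R v.

Lemma barycenter_inj (R : realType) (d : nat) (u v : 'rV[nat]_d) :
  u != v -> injective (fun t : R => barycenter t u v).
Proof.
move=> uv s t /rowP st; apply/eqP; apply: contraNT uv => st'.
apply/eqP/(@to_real_inj R)/rowP => j; have := st j; rewrite !mxE.
move: (u _ _)%:R (v _ _)%:R => x y h.
have /eqP : (s - t) * (y - x) = 0 by lra.
by rewrite mulf_eq0 !subr_eq0 (negPf st') => /eqP.
Qed.

Lemma barycenter_division_point (R : realType) (d k i : nat) (u v : 'rV[nat]_d) :
  (i < k)%N -> barycenter (i%:R / k%:R : R) u v =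
    \row_j ((division_point k i u v j)%:R / k%:R).
Proof.
move=> ik; apply/rowP => j; rewrite !mxE ffunE natrD !natrM natrB 1?ltnW //.
have k0 : k%:R != 0 :> R by rewrite pnatr_eq0 -lt0n (leq_ltn_trans _ ik).
by field.
Qed.

(** From i l = j k, Gauss' lemma makes k and l divide each other. *)
Lemma coprime_fraction_inj (R : realType) (k i l j : nat) :
  (0 < k)%N -> (0 < l)%N -> coprime k i -> coprime l j ->
  i%:R / k%:R = j%:R / l%:R :> R -> k = l /\ i = j.
Proof.
move=> k0 l0 ki lj /eqP.
rewrite eqr_div ?pnatr_eq0 -?lt0n // -!natrM eqr_nat => /eqP e.
have kl : k = l.
  apply/eqP; rewrite eqn_dvd -(Gauss_dvdr l ki) e dvdn_mull //=.
  by rewrite -(Gauss_dvdr k lj) -e dvdn_mull.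
by split=> //; apply/eqP; rewrite -(eqn_pmul2r l0) e kl.
Qed.

Lemma sum_meetings_le_cr (R : realType) (d K : nat) (G : grid_graph d)
    (u v : edges G -> 'rV[nat]_d) :
  proper_grid_graph R G -> (forall e, u e != v e) ->
  (forall e, open_segment (to_real R (u e)) (to_real R (v e)) `<=` segment (val e))%classic ->
  (\sum_(2 <= k < K.+1) #|meetings K k u v| <= 2 * cr R G)%N.
Proof.
move=> prG uv sub; apply: leq_trans (ordered_crossings_le R G).
have inside k i e : (1 < k)%N -> (i < k)%N -> coprime k i ->
    segment (val e) (barycenter (i%:R / k%:R : R) (u e) (v e)).
  move=> k1 ik ci; apply: sub; exists (i%:R / k%:R) => //.
  have k0 : 0 < k%:R :> R by rewrite ltr0n ltnW.
  rewrite ltr_pdivrMr // mul1r ltr_nat ik divr_gt0 // ltr0n lt0n.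
  by apply: contraTneq ci => ->; rewrite /coprime gcdn0; case: eqP k1 => // ->.
have same k i i' e e' : (i < k)%N -> (i' < k)%N ->
    division_point k i (u e) (v e) = division_point k i' (u e') (v e') ->
    barycenter (i%:R / k%:R : R) (u e) (v e) = barycenter (i'%:R / k%:R) (u e') (v e').
  by move=> ik ik' h; rewrite !barycenter_division_point // h.
apply: sum_meetings_le => [k i i' e e' ik ik' ci ci' k1 ee' h|].
  rewrite inE; split=> //.
  exists (barycenter (i%:R / k%:R : R) (u e) (v e)); split; first exact: inside.
  by rewrite (same _ _ _ _ _ ik ik' h); apply: inside.
move=> k i i' l j j' e e' k1 l1 ik ik' ci ci' jl jl' cj cj' ee' h h'.
have s := same _ _ _ _ _ ik ik' h; have s' := same _ _ _ _ _ jl jl' h'.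
have pq : barycenter (i%:R / k%:R : R) (u e) (v e) = barycenter (j%:R / l%:R) (u e) (v e).
  apply: (edges_meet_once prG (fsvalP e) (fsvalP e') ee').
  - exact: inside.
  - by rewrite s; apply: inside.
  - exact: inside.
  - by rewrite s'; apply: inside.
have pq' := pq; rewrite s s' in pq'.
have [kl ij] := coprime_fraction_inj (ltnW k1) (ltnW l1) ci cj (barycenter_inj (uv e) pq).
have [_ ij'] := coprime_fraction_inj (ltnW k1) (ltnW l1) ci' cj' (barycenter_inj (uv e') pq').
by [].
Qed.

Lemma division_point_bounds (d k i : nat) (u v : 'rV[nat]_d) (X : 'I_d -> nat) (j : 'I_d) :
  (i < k)%N -> (0 < u ord0 j <= X j)%N -> (0 < v ord0 j <= X j)%N ->
  (0 < division_point k i u v j <= k * X j)%N.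
Proof. by rewrite ffunE; move: (u _ _) (v _ _) => x y ik h1 h2; nia. Qed.

(** t k is the number of ordered pairs of edges that meet at points of
    denominator k.  The second inequality improves on the case k = 2 of the
    first: midpoints of the chosen subsegments avoid the lattice, which replaces
    2^d by 2^d - 1. *)
Lemma crossings_by_denominator (R : realType) (d K : nat) (G : grid_graph d) :
  proper_grid_graph R G -> exists t : nat -> nat,
    [/\ forall k, (1 < k <= K)%N ->
          ((#|` edges G|%fset * totient k) ^ 2 <=
             k ^ d * vol G * (t k + #|` edges G|%fset * totient k))%N,
        (2 <= K)%N -> (#|` edges G|%fset ^ 2 <=
             (2 ^ d).-1 * vol G * (t 2 + #|` edges G|%fset))%N &
        (\sum_(2 <= k < K.+1) t k <= 2 * cr R G)%N].
Proof.
move=> prG; have [u [v uvP]] := odd_subsegments R G.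
have uv e : u e != v e by have [] := uvP e.
pose M k := (\max_j (k * side G j))%N.
have kM k j : (k * side G j <= M k)%N by rewrite (leq_bigmax j).
have dp k e i j : (i < k)%N ->
    (0 < division_point k i (u e) (v e) j <= k * side G j)%N.
  by move=> ik; have [_ _ /(_ j)[? ?] _] := uvP e; apply: division_point_bounds.
have dM k e i j : (i < k)%N -> (division_point k i (u e) (v e) j <= M k)%N.
  by move=> ik; have /andP[_ /leq_trans->] := dp k e i j ik.
exists (fun k => #|meetings K k u v|); split; last first.
- by apply: sum_meetings_le_cr => // e; have [] := uvP e.
- move=> K2; have := meetings_ge K2 uv (dM 2).
  rewrite -(card_odd_box (kM 2)) -cardfE [totient 2]/= muln1; apply.
  move=> e i i2 ci; rewrite inE; apply/andP; split.
    by apply/forallP => j; rewrite ffunE inordK ?dp // ltnS dM.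
  have [_ [j oj] _ _] := uvP e; apply/existsP; exists j.
  (* the only index coprime to 2 is i = 1, where the division point is u + v *)
  rewrite ffunE inordK ?ltnS ?dM //; case: i i2 ci => [|[|]] // _ _.
  by rewrite ffunE !mul1n.
move=> k /andP[k1 kK].
have kM1 j : (1 * (k * side G j) <= M k)%N by rewrite mul1n.
have := card_box (ltn0Sn 0) kM1; rewrite big_split /= prod_nat_const card_ord => <-.
have := meetings_ge kK uv (dM k); rewrite -cardfE; apply.
move=> e i ik ci; rewrite inE; apply/forallP => j.
by rewrite dvd1n andbT ffunE inordK ?mul1n ?dp // ltnS dM.
Qed.

(** * The two regimes in dimension three *)

(** The midpoints alone: m^2 <= 7 N (2 cr + m), and 7 N <= 7 m / 8. *)
Lemma crossings_linear (R : realType) (N : nat) (G : grid_graph 3) :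
  proper_grid_graph R G -> (0 < N)%N -> (vol G <= N)%N ->
  (8 * N <= #|` edges G|%fset)%N -> (#|` edges G|%fset <= 14 * cr R G)%N.
Proof.
move=> prG N0 volN; have [t [_ /(_ isT) + +]] := crossings_by_denominator 2 prG.
rewrite big_nat1; move: (t 2) (cr R G) => t2 c; set m := #|` _|%fset => h h' mN.
have m0 : (0 < m)%N by lia.
have : (8 * m ^ 2 <= 7 * m * (2 * c + m))%N.
  apply: (@leq_trans (8 * (7 * N * (t2 + m)))%N).
    rewrite leq_mul2l /= (leq_trans h) // leq_mul2r; apply/orP; right.
    by rewrite leq_mul2l.
  by rewrite (_ : 8 * _ = 7 * (8 * N) * (t2 + m))%N ?leq_mul ?leq_add2r //; lia.
by rewrite -mulnn => le; rewrite -(leq_pmul2l m0); nia.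
Qed.

Lemma meetings_lower_bound (R : realType) (N m k phi t V : nat) :
  (0 < N)%N -> (0 < k)%N -> (V <= N)%N ->
  ((m * phi) ^ 2 <= k ^ 3 * V * (t + m * phi))%N ->
  m%:R ^+ 2 / N%:R * (phi%:R ^+ 2 * k%:R^-1 ^+ 3) - m%:R * phi%:R <= t%:R :> R.
Proof.
move=> N0 k0 VN h.
have {}h : ((m * phi) ^ 2 <= k ^ 3 * N * (t + m * phi))%N.
  by apply: leq_trans h _; rewrite leq_mul2r leq_mul2l VN !orbT.
have NR : 0 < N%:R :> R by rewrite ltr0n.
have kR : 0 < k%:R :> R by rewrite ltr0n.
have kN : 0 < k%:R ^+ 3 * N%:R :> R by rewrite mulr_gt0 ?exprn_gt0.
rewrite lerBlDr.
have -> : m%:R ^+ 2 / N%:R * (phi%:R ^+ 2 * k%:R^-1 ^+ 3) =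
    (m%:R * phi%:R) ^+ 2 / (k%:R ^+ 3 * N%:R) :> R by field; rewrite !gt_eqF.
rewrite ler_pdivrMr // [leRHS]mulrC; move: h.
by rewrite -(ler_nat R) !(natrM, natrX, natrD).
Qed.

(** The denominators are cut off at K = floor (sqrt (m / N)): up to there the
    subtracted terms m phi(k) add up to at most m K^2 <= m^2 / N, while K is still
    large enough for the harmonic sum to reach ln (m / N) / 2.  In the constant 2,
    one unit is the loss and the other the missing term k = 1. *)
Lemma crossings_log (R : realType) (N : nat) (G : grid_graph 3) :
  proper_grid_graph R G -> (0 < N)%N -> (vol G <= N)%N -> (N <= #|` edges G|%fset)%N ->
  let m : R := #|` edges G|%fset%:R in
  m ^+ 2 / N%:R * (ln (m / N%:R) / 8 - 2) <= 2 * (cr R G)%:R.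
Proof.
move=> prG N0 volN Nm /=; set m := #|` _|%fset.
have exK : exists K, (K ^ 2 * N <= m)%N by exists 1%N; rewrite mul1n.
have ubK K : (K ^ 2 * N <= m)%N -> (K <= m)%N by nia.
have [K Km Kmax] := ex_maxnP exK ubK.
have mK : (m < K.+1 ^ 2 * N)%N.
  by rewrite ltnNge; apply/negP => /Kmax; rewrite ltnn.
have K0 : (0 < K)%N by apply: Kmax; rewrite mul1n.
have [t [tlow _ tsum]] := crossings_by_denominator K prG.
have NR : 0 < N%:R :> R by rewrite ltr0n.
have m0 : (0 < m)%N by rewrite (leq_trans N0).
have mR : 0 < m%:R :> R by rewrite ltr0n.
pose S : R := \sum_(1 <= k < K.+1) (totient k)%:R ^+ 2 * k%:R^-1 ^+ 3.
have S1 : S = 1 + \sum_(2 <= k < K.+1) (totient k)%:R ^+ 2 * k%:R^-1 ^+ 3.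
  by rewrite /S big_ltn // invr1 !expr1n mulr1.
have lnS : ln (m%:R / N%:R) <= 8 * S :> R.
  apply: (@le_trans _ _ (ln (K.+1%:R ^+ 2))).
    rewrite ler_ln ?posrE ?divr_gt0 ?exprn_gt0 ?ltr0n // ler_pdivrMr //.
    by rewrite -natrX -natrM ler_nat ltnW.
  rewrite expr2 lnM ?posrE ?ltr0n //.
  have := ln_le_harmonic_sum R K; have := harmonic_sum_le_totient_sqr R K.
  by rewrite -/S; lra.
have lossE : \sum_(2 <= k < K.+1) (m%:R * (totient k)%:R : R) <= m%:R ^+ 2 / N%:R.
  rewrite -big_distrr /= expr2 -mulrA ler_pM2l // ler_pdivlMr //.
  rewrite -natr_sum -natrM ler_nat; apply: leq_trans Km.
  rewrite leq_mul2r; apply/orP; right.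
  apply: (@leq_trans (\sum_(2 <= k < K.+1) K)%N).
    rewrite big_nat [leqRHS]big_nat; apply: leq_sum => k /andP[_ kK].
    rewrite (leq_trans _ (kK : (k <= K)%N)) // totient_count_coprime big_mkord.
    by rewrite -[leqRHS]card_ord -sum1_card; apply: leq_sum => i _; case: coprime.
  by rewrite sum_nat_const_nat -mulnn leq_mul2r; lia.
have {}tsum : \sum_(2 <= k < K.+1) (t k)%:R <= 2 * (cr R G)%:R :> R.
  by rewrite -natr_sum -natrM ler_nat.
apply: le_trans tsum.
apply: (@le_trans _ _ (\sum_(2 <= k < K.+1)
    (m%:R ^+ 2 / N%:R * ((totient k)%:R ^+ 2 * k%:R^-1 ^+ 3) - m%:R * (totient k)%:R))).
  rewrite sumrB -big_distrr /=.
  have q0 : 0 <= m%:R ^+ 2 / N%:R :> R by rewrite divr_ge0 ?exprn_ge0.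
  move: lossE q0 S1 lnS; set Q := m%:R ^+ 2 / _; set T := \sum_(_ <= _ < _) _ * _.
  move=> lossE q0 S1; set L := ln _ => lnS.
  apply: (@le_trans _ _ (Q * (S - 1) - Q)); last first.
    by rewrite S1 addrAC subrr add0r lerB.
  by rewrite (_ : Q * (S - 1) - Q = Q * (S - 2)); [rewrite ler_wpM2l //; lra|ring].
rewrite big_nat [leRHS]big_nat; apply: ler_sum => k /andP[k2 kK].
apply: (@meetings_lower_bound R N m k _ _ (vol G)) => //; first exact: ltnW.
by apply: tlow; rewrite k2.
Qed.

Theorem theorem1 (R : realType) :
  exists2 c : R, 0 < c &
    forall N m : nat, (0 < N)%N -> (8 * N <= m)%N ->
      ((c * (m%:R ^+ 2 / N%:R) * ln (m%:R / N%:R))%:E <= min_cr R 3 N m)%E.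
Proof.
have e0 : 0 < expR 32 :> R by apply: expR_gt0.
have e1 : 1 <= expR 32 :> R by apply: le_trans (expR_ge1Dx _); lra.
(* 448 = 14 * 32: the linear bound has the factor 14, and the two regimes are
   separated at ln (m / N) = 32, where ln (m / N) / 8 - 2 = ln (m / N) / 16. *)
pose c : R := (448 * expR 32)^-1.
have k0 : 0 < 448 :> R by rewrite ltr0n.
have ke0 : 0 < 448 * expR 32 :> R by apply: mulr_gt0.
have c0 : 0 < c by rewrite invr_gt0.
exists c => // N m N0 mN; apply: le_ereal_inf_tmp => _ [G [prG Gm volN] <-].
rewrite lee_fin; subst m.
have Nm : (N <= #|` edges G|%fset)%N by apply: leq_trans mN; rewrite leq_pmull.
have lin := crossings_linear prG N0 volN mN.
have := crossings_log prG N0 volN Nm; rewrite /=; move: lin Nm mN.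
set m := #|` _|%fset => lin Nm mN.
have NR : 0 < N%:R :> R by rewrite ltr0n.
have m0 : (0 < m)%N by rewrite (leq_trans N0).
have mR : 0 < m%:R :> R by rewrite ltr0n.
have q0 : 0 < m%:R ^+ 2 / N%:R :> R by rewrite divr_gt0 ?exprn_gt0.
have L0 : 0 <= ln (m%:R / N%:R) :> R by rewrite ln_ge0 // ler_pdivlMr // mul1r ler_nat.
have {}lin : m%:R <= 14 * (cr R G)%:R :> R by rewrite -natrM ler_nat.
have [L32|L32] := lerP 32 (ln (m%:R / N%:R) : R) => h.
  have : m%:R ^+ 2 / N%:R * (ln (m%:R / N%:R) / 16) <= 2 * (cr R G)%:R :> R.
    by apply: le_trans h; rewrite ler_wpM2l ?(ltW q0) //; lra.
  have : c * (m%:R ^+ 2 / N%:R * ln (m%:R / N%:R)) <=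
      32^-1 * (m%:R ^+ 2 / N%:R * ln (m%:R / N%:R)).
    apply: ler_wpM2r; first by rewrite mulr_ge0 // ltW.
    by rewrite lef_pV2 ?posrE //; lra.
  by rewrite -mulrA; lra.
have mNe : m%:R / N%:R <= expR 32 :> R.
  rewrite -[leLHS]lnK ?posrE ?divr_gt0 // ler_expR; exact: ltW.
have : c * (m%:R ^+ 2 / N%:R) * ln (m%:R / N%:R) <= c * (m%:R * expR 32) * 32.
  apply: ler_pM => //; [by rewrite mulr_ge0 ?ltW | | exact: ltW].
  by rewrite ler_pM2l // expr2 -mulrA ler_pM2l.
have -> : c * (m%:R * expR 32) * 32 = m%:R / 14 by rewrite /c; field; rewrite gt_eqF.
by move=> /le_trans; apply; lra.
Qed.
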